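(* Let $\mathcal{P}\subset\Delta(\mathcal{S})^{\mathcal{S}\times\mathcal{A}}$ be a nonempty compact convex uncertainty set that is weakly s-tractable. Let $r\in\mathbb{R}^{\mathcal{S}\times\mathcal{A}}$, $\gamma\in(0,1)$, $\mu\in\Delta(\mathcal{S})$ and $\pi\in\Pi_{\mathsf S}$. Then $$\inf_{P\in\mathcal{P}_{\mathsf H}}\mu^\top v^{\pi,P}=\min_{P\in\mathcal{P}}\mu^\top v^{\pi,P}.$$
   Context: $\mathcal{S}$ (states) and $\mathcal{A}$ (actions) are finite nonempty sets; $\Delta(E)$ denotes the set of probability distributions on a finite set $E$. Elements of an uncertainty set $\mathcal{P} \subset \Delta(\mathcal{S})^{\mathcal{S}\times\mathcal{A}}$ are written $P=(P_{sa})_{(s,a)}$ with $P_{sa}\in\Delta(\mathcal{S})\subset\mathbb{R}^{\mathcal{S}}$. Stationary policies: $\Pi_{\mathsf S}=\Delta(\mathcal{A})^{\mathcal{S}}$, $\pi=(\pi_{sa})$. $\mathcal{P}_{\mathsf H}$ is the set of history-dependent (non-stationary) adversaries: maps $P$ assigning to each finite history $h_t=(s_0,a_0,\dots,s_{t-1},a_{t-1},s_t)$, $t\ge0$, an element $P(h_t)\in\mathcal{P}$; at time $t$, after action $a_t$ is drawn, the next state is drawn from $P(h_t)_{s_ta_t}$. Constant maps are identified with elements of $\mathcal{P}$. Rewards are independent of the next state: $r=(r_{sa})\in\mathbb{R}^{\mathcal{S}\times\mathcal{A}}$. For $\gamma\in[0,1)$, $v^{\pi,P}_s=\mathbb{E}^{\pi,P}\big[\sum_{t\ge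 0}\gamma^t r_{s_ta_t}\,\big|\,s_0=s\big]$ (with $0^0=1$), for $\pi\in\Pi_{\mathsf S}$ and $P\in\mathcal{P}$ or $P\in\mathcal{P}_{\mathsf H}$. $u^{\pi}\in\mathbb{R}^{\mathcal{S}}$ is the unique vector satisfying $u^\pi_s=\min_{P\in\mathcal{P}}\sum_{a}\pi_{sa}(r_{sa}+\gamma P_{sa}^\top u^\pi)$ for all $s$. $\mathcal{P}$ is weakly s-tractable if for all $\pi\in\Pi_{\mathsf S}$, $r\in\mathbb{R}^{\mathcal{S}\times\mathcal{A}}$, $\gamma\in[0,1)$, $\mu\in\Delta(\mathcal{S})$: $\min_{P\in\mathcal{P}}\mu^\top v^{\pi,P}=\mu^\top u^\pi$. *)

(* Defs.v *)
From HB Require Import structures.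
From mathcomp Require Import all_boot all_order all_algebra.
From mathcomp Require Import all_classical all_reals all_analysis.
Import Order.TTheory GRing.Theory Num.Theory.
Import numFieldNormedType.Exports.

Set Implicit Arguments.
Unset Strict Implicit.
Unset Printing Implicit Defensive.

Local Open Scope classical_set_scope.
Local Open Scope ring_scope.

Definition is_minimum (R : realType) (E : set R) (m : R) : Prop :=
  E m /\ lbound E m.

Definition simplex (R : realType) (E : finType) : set (E -> R) :=
  [set p | (forall x, 0 <= p x) /\ \sum_x p x = 1].

(* [P s a s'] is the probability of moving to [s'] when [a] is played in [s].
   The topology of [transition] is that of pointwise convergence, i.e., the usual
   topology of R^(S x A x S). *)
Definition transition (R : realType) (S A : finType) : Type :=
  {ptws S -> {ptws A -> {ptws S -> R}}}.

Definition stochastic_transition (R : realType) (S A : finType) :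
    set (transition R S A) :=
  [set P | forall s a, simplex (P s a)].

(* The same underlying functions, with their pointwise vector space
   structure. *)
Definition convex_uncertainty (R : realType) (S A : finType)
    (U : set (transition R S A)) : Prop :=
  @convex_set R (S -> A -> S -> R^o) U.

Definition stationary_policy (R : realType) (S A : finType) :
    set (S -> A -> R) :=
  [set pi | forall s, simplex (pi s)].

(* [([:: (s_0, a_0); ...; (s_(t-1), a_(t-1))], s_t)] *)
Definition history (S A : finType) : Type := (seq (S * A) * S)%type.

Definition adversary (R : realType) (S A : finType) : Type :=
  history S A -> transition R S A.

Definition history_adversaries (R : realType) (S A : finType)
    (U : set (transition R S A)) : set (adversary R S A) :=
  [set P | forall h, U (P h)].

Definition history_event (S A : finType) (Omega : Type)
    (st : nat -> Omega -> S) (ac : nat -> Omega -> A) (h : history S A) :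
    set Omega :=
  [set w | mkseq (fun i => (st i w, ac i w)) (size h.1) = h.1 /\
           st (size h.1) w = h.2].

(* The law of the state-action process is prescribed in product form
   rather than by conditional probabilities, so that histories of probability
   zero need no special treatment. *)
Definition generated_process (R : realType) (S A : finType)
    (pi : S -> A -> R) (P : adversary R S A) (s0 : S)
    (d : measure_display) (Omega : measurableType d) (Pr : probability Omega R)
    (st : nat -> Omega -> S) (ac : nat -> Omega -> A) : Prop :=
  [/\ forall t s, measurable [set w | st t w = s],
      forall t a, measurable [set w | ac t w = a],
      Pr [set w | st 0%N w = s0] = 1%E,
      forall (h : history S A) a,
        Pr (history_event st ac h `&` [set w | ac (size h.1) w = a]) =
        (Pr (history_event st ac h) * (pi h.2 a)%:E)%E &
      forall (h : history S A) a s',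
        Pr (history_event st ac (rcons h.1 (h.2, a), s')) =
        (Pr (history_event st ac h `&` [set w | ac (size h.1) w = a]) *
         (P h h.2 a s')%:E)%E].

Definition discounted_return (R : realType) (S A : finType) (r : S -> A -> R)
    (gamma : R) (s : nat -> S) (a : nat -> A) : R :=
  limn (series (fun t => gamma ^+ t * r (s t) (a t))).

(* Processes generated by [pi] and [P] from [s] exist (Ionescu-Tulcea) and all
   have the same law, so that the set below is a singleton as soon as [pi] and
   the [P h] are stochastic and [0 <= gamma < 1]. *)
Definition value (R : realType) (S A : finType) (r : S -> A -> R) (gamma : R)
    (pi : S -> A -> R) (P : adversary R S A) (s : S) : R :=
  get [set v : R | exists (d : measure_display) (Omega : measurableType d)
    (Pr : probability Omega R)
    (st : nat -> Omega -> S) (ac : nat -> Omega -> A),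
    generated_process pi P s Pr st ac /\
    ('E_Pr[(fun w => discounted_return r gamma (st^~ w) (ac^~ w))] =
      v%:E)%E].

Definition mean_value (R : realType) (S A : finType) (r : S -> A -> R)
    (gamma : R) (mu : S -> R) (pi : S -> A -> R) (P : adversary R S A) : R :=
  \sum_s mu s * value r gamma pi P s.

Definition robust_bellman_solution (R : realType) (S A : finType)
    (U : set (transition R S A)) (r : S -> A -> R) (gamma : R) (pi : S -> A -> R)
    (u : S -> R) : Prop :=
  forall s, is_minimum
    [set \sum_a pi s a * (r s a + gamma * \sum_s' P s a s' * u s') | P in U]
    (u s).

(* For nonempty compact [U] and [0 <= gamma < 1] the solution exists and is
   unique, the robust Bellman operator being a contraction. *)
Definition robust_value (R : realType) (S A : finType)
    (U : set (transition R S A)) (r : S -> A -> R) (gamma : R) (pi : S -> A -> R) :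
    S -> R :=
  get [set u : S -> R | robust_bellman_solution U r gamma pi u].

Definition weakly_s_tractable (R : realType) (S A : finType)
    (U : set (transition R S A)) : Prop :=
  forall (pi : S -> A -> R) (r : S -> A -> R) (gamma : R) (mu : S -> R),
    stationary_policy pi -> 0 <= gamma < 1 -> simplex mu ->
    is_minimum [set mean_value r gamma mu pi (cst P) | P in U]
      (\sum_s mu s * robust_value U r gamma pi s).

(* Main.v *)
Require Import Defs.
From HB Require Import structures.
From mathcomp Require Import all_boot all_order all_algebra.
From mathcomp Require Import all_classical all_reals all_analysis.
From mathcomp Require Import measurable_realfun ring.
Import Order.TTheory GRing.Theory Num.Theory.
Import numFieldNormedType.Exports.

(** Let [u] be the robust value.  Being the fixed point of the robust Bellman
    operator, it satisfies [u s <= bellman r gamma pi Q u s] for every [Q] in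
    [U].  An adversary of any memory still answers each history with some
    element of [U], so at every step the expected gain
    [r s_t a_t + gamma * u s_(t+1) - u s_t] is nonnegative.  Summing these gains
    with weights [gamma ^ t] telescopes, and gives
    [u s_0 <= E (return up to n) + gamma ^ n E (u s_n)]; letting [n] go to
    infinity, the value of every history-dependent adversary is at least [u]
    ([value_ge]).  Weak tractability says that [mu^T u] is attained by a constant
    adversary of [U], which is in particular history-dependent; hence [mu^T u] is
    at once the infimum over all adversaries and the minimum over constant ones.

    The robust value and the value of an adversary are both picked from sets by
    a choice operator, so the argument rests on two existence theorems.

    - The robust Bellman equation has a solution
      ([robust_bellman_solution_exists]).  Rather than the contraction principle,
      monotonicity is used, as in the Knaster-Tarski theorem: the pointwise
      supremum of all subsolutions is a subsolution, and it is a fixed point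
      since the Bellman operator maps subsolutions to subsolutions.  Compactness
      serves to attain the minimum over [U].

    - The controlled process exists ([generated_process_exists]).  Since states
      and actions are finite, a uniform point of the unit interval suffices:
      every word of length [n] over the alphabet [S * A] gets a subinterval as
      long as its probability, the subintervals of its one-letter extensions
      cut it into pieces, and the process reads off the infinite word whose
      prefixes all have the point in their subinterval
      ([word_process_exists]). *)

Local Open Scope classical_set_scope.
Local Open Scope ring_scope.

Set Implicit Arguments.
Unset Strict Implicit.
Unset Printing Implicit Defensive.

(** * Means with respect to finite distributions *)

Section finite_distributions.
Variables (R : realType) (E : finType).
Implicit Types (p f g : E -> R).

Lemma ler_norm_sum_fin f e : `|f e| <= \sum_x `|f x|.
Proof. by rewrite (bigD1 e)//= lerDl sumr_ge0. Qed.

Lemma simplex_mean_le p f g : simplex p -> (forall e, f e <= g e) ->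
  \sum_e p e * f e <= \sum_e p e * g e.
Proof. by move=> [p0 _] fg; apply: ler_sum => e _; rewrite ler_wpM2l. Qed.

Lemma simplex_mean_cst p c : simplex p -> \sum_e p e * c = c.
Proof. by move=> [_ p1]; rewrite -mulr_suml p1 mul1r. Qed.

End finite_distributions.

Lemma ler_norm_sum2_fin (R : realType) (E F : finType) (f : E -> F -> R) e x :
  `|f e x| <= \sum_e' \sum_x' `|f e' x'|.
Proof.
apply: (le_trans (ler_norm_sum_fin (f e) x)).
by rewrite [leRHS](bigD1 e)//= lerDl sumr_ge0// => e' _; rewrite sumr_ge0.
Qed.

(** * The robust Bellman equation *)

Definition bellman {R : realType} {S A : finType} (r : S -> A -> R) (gamma : R)
    (pi : S -> A -> R) (P : transition R S A) (w : S -> R) (s : S) : R :=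
  \sum_a pi s a * (r s a + gamma * \sum_s' P s a s' * w s').

Section robust_bellman.
Variables (R : realType) (S A : finType) (U : set (transition R S A)).
Hypothesis U_stochastic : U `<=` @stochastic_transition R S A.
Variables (r : S -> A -> R) (gamma : R) (pi : S -> A -> R).
Hypotheses (gamma_ge0 : 0 <= gamma) (gamma_lt1 : gamma < 1).
Hypothesis pi_policy : stationary_policy pi.

Lemma bellman_le P w w' s : U P -> (forall s', w s' <= w' s') ->
  bellman r gamma pi P w s <= bellman r gamma pi P w' s.
Proof.
move=> UP ww'; apply: simplex_mean_le => // a.
by rewrite lerD2l ler_wpM2l// simplex_mean_le//; exact: U_stochastic.
Qed.

Lemma bellman_cst P c s : U P ->
  bellman r gamma pi P (cst c) s = \sum_a pi s a * r s a + gamma * c.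
Proof.
move=> UP; rewrite -[in RHS](simplex_mean_cst (gamma * c) (pi_policy s)).
rewrite -big_split/=; apply: eq_bigr => a _.
by rewrite simplex_mean_cst ?mulrDr//; exact: U_stochastic.
Qed.

Lemma bellman_continuous (w : S -> R) s :
  continuous (fun P : transition R S A => bellman r gamma pi P w s).
Proof.
move=> P; have FP : Filter (nbhs P) by exact: nbhs_filter.
apply: cvg_big => //; first exact: add_continuous.
move=> a _; apply: cvgM; first exact: cvg_cst.
apply: cvgD; first exact: cvg_cst.
apply: cvgM; first exact: cvg_cst.
apply: cvg_big => //; first exact: add_continuous.
move=> s' _; apply: cvgM; last exact: cvg_cst.
have c1 := @proj_continuous S (fun=> {ptws A -> {ptws S -> R}}) s P.
have c2 := @proj_continuous A (fun=> {ptws S -> R}) a (P s).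
have c3 := @proj_continuous S (fun=> R) s' (P s a).
exact: (cvg_comp _ _ (cvg_comp _ _ c1 c2) c3).
Qed.

Hypotheses (U_nonempty : U !=set0) (U_compact : compact U).

Lemma robust_bellman_minimum (w : S -> R) s :
  exists m, is_minimum [set bellman r gamma pi P w s | P in U] m.
Proof.
have [|P /set_mem UP Pmin] := @compact_EVT_min _ _
  (fun P : transition R S A => bellman r gamma pi P w s) U U_nonempty U_compact.
  exact/continuous_subspaceT/bellman_continuous.
exists (bellman r gamma pi P w s); split; first by exists P.
by move=> _ [Q UQ <-]; apply: Pmin; rewrite inE.
Qed.

Definition bellman_subsolution : set (S -> R) :=
  [set w | forall P s, U P -> w s <= bellman r gamma pi P w s].

Let M : R := \sum_s \sum_a `|r s a|.

Let mean_r_le s : \sum_a pi s a * r s a <= M.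
Proof.
rewrite -[leRHS](simplex_mean_cst M (pi_policy s)).
apply: simplex_mean_le => // a.
exact/(le_trans (ler_norm _))/ler_norm_sum2_fin.
Qed.

Let mean_r_ge s : - M <= \sum_a pi s a * r s a.
Proof.
rewrite -[leLHS](simplex_mean_cst (- M) (pi_policy s)).
apply: simplex_mean_le => // a; rewrite lerNl.
by apply: le_trans (ler_norm_sum2_fin r s a); rewrite -normrN ler_norm.
Qed.

(** At a state [m] where [w] is maximal, the subsolution inequality reads
    [w m <= M + gamma * w m], because the next value is at most [w m]. *)
Lemma bellman_subsolution_bounded w s :
  bellman_subsolution w -> w s <= M / (1 - gamma).
Proof.
move=> sub_w; have [P UP] := U_nonempty.
pose m := [arg max_(x > s) w x]%O.
have w_le x : w x <= w m by rewrite /m; case: arg_maxP => // i _; exact.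
apply: (le_trans (w_le s)); rewrite ler_pdivlMr ?subr_gt0//.
have : w m <= M + gamma * w m.
  apply: (le_trans (sub_w P m UP)).
  apply: (le_trans (bellman_le (w' := cst (w m)) m UP w_le)).
  by rewrite bellman_cst// lerD2r mean_r_le.
by rewrite mulrBr mulr1 [w m * _]mulrC lerBlDr.
Qed.

(** The supremum [u] of the subsolutions is a subsolution by monotonicity.  The
    minimum [m] over [U] of the Bellman values at [u] dominates [u], and is
    again a subsolution by monotonicity, so it is also dominated by [u]. *)
Lemma robust_bellman_solution_exists :
  exists u, robust_bellman_solution U r gamma pi u.
Proof.
pose u s := sup [set w s | w in bellman_subsolution].
have sub_has_sup s : has_sup [set w s | w in bellman_subsolution].
  split; last first.
    exists (M / (1 - gamma)) => _ [w sub_w <-].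
    exact: bellman_subsolution_bounded.
  (* The constant [c] with [c = - M + gamma * c] is a subsolution. *)
  exists (- (M / (1 - gamma))), (cst (- (M / (1 - gamma)))) => // P s' UP.
  rewrite bellman_cst//; apply: le_trans (lerD (mean_r_ge s') (lexx _)) => /=.
  have g0 : 1 - gamma != 0 by rewrite gt_eqF// subr_gt0.
  by rewrite le_eqVlt; apply/orP; left; apply/eqP; field.
have u_max w s : bellman_subsolution w -> w s <= u s.
  by move=> sub_w; apply: sup_upper_bound => //; exists w.
have sub_u : bellman_subsolution u.
  move=> P s UP; apply: ge_sup; first by case: (sub_has_sup s).
  move=> _ [w sub_w <-]; apply: (le_trans (sub_w P s UP)).
  by apply: bellman_le => // s'; exact: u_max.
have /choice[m m_min] : forall s, exists m,
    is_minimum [set bellman r gamma pi P u s | P in U] m.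
  by move=> s; exact: robust_bellman_minimum.
have u_le_m s : u s <= m s.
  by have [[P UP <-] _] := m_min s; exact: sub_u.
have sub_m : bellman_subsolution m.
  move=> P s UP; apply: (@le_trans _ _ (bellman r gamma pi P u s)).
    by have [_] := m_min s; apply; exists P.
  exact: bellman_le.
exists u => s.
have -> : u s = m s by apply/eqP; rewrite eq_le u_le_m u_max.
exact: m_min.
Qed.

Lemma robust_value_bellman :
  robust_bellman_solution U r gamma pi (robust_value U r gamma pi).
Proof. exact: (getPex robust_bellman_solution_exists). Qed.

End robust_bellman.

(** * Finitely valued random variables *)

Section finitely_valued.
Context d (T : measurableType d) (R : realType) (Pr : probability T R).
Variables (I : finType) (Z : T -> I).
Hypothesis mZ : forall i, measurable [set w | Z w = i].

Let comp_sum_indic (f : I -> R) w :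
  f (Z w) = \sum_i f i * \1_[set w | Z w = i] w.
Proof.
rewrite (bigD1 (Z w))//= indicE mem_set// mulr1 big1 ?addr0// => i iZ.
by rewrite indicE memNset ?mulr0// => /= Zi; rewrite Zi eqxx in iZ.
Qed.

Lemma finitely_valued_integrable (f : I -> R) :
  Pr.-integrable setT (EFin \o (f \o Z)).
Proof.
rewrite (_ : _ \o _ = fun w => \sum_i (f i * \1_[set w | Z w = i] w)%:E)%E.
  apply: integrable_sum => // i _.
  apply: (@integrableZl _ _ _ _ _ _ (f i) (EFin \o \1_[set w | Z w = i])) => //.
  exact: integrable_indic.
by apply/funext => w /=; rewrite comp_sum_indic sumEFin.
Qed.

Lemma integral_finitely_valued (f : I -> R) :
  (\int[Pr]_w (f (Z w))%:E = \sum_i (f i)%:E * Pr [set w | Z w = i])%E.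
Proof.
under eq_integral do rewrite comp_sum_indic -sumEFin.
rewrite integral_sum//.
  apply: eq_bigr => i _; under eq_integral do rewrite /= EFinM.
  by rewrite integralZl ?integral_indic ?setIT//; exact: integrable_indic.
move=> i.
apply: (@integrableZl _ _ _ _ _ _ (f i) (EFin \o \1_[set w | Z w = i])) => //.
exact: integrable_indic.
Qed.

End finitely_valued.

Lemma measurable_pair_fiber d (T : measurableType d) (I J : finType)
    (Y : T -> I) (Z : T -> J) :
    (forall i, measurable [set w | Y w = i]) ->
    (forall j, measurable [set w | Z w = j]) ->
  forall ij, measurable [set w | (Y w, Z w) = ij].
Proof.
move=> mY mZ [i j].
rewrite (_ : [set w | _] = [set w | Y w = i] `&` [set w | Z w = j]).
  exact: measurableI.
by apply/seteqP; split=> w /= [-> ->].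
Qed.

Lemma measurable_mkseq_fiber d (T : measurableType d) (I : finType)
    (Z : nat -> T -> I) :
    (forall t i, measurable [set w | Z t w = i]) ->
  forall l, measurable [set w | mkseq (Z^~ w) (size l) = l].
Proof.
move=> mZ; elim/last_ind=> [|l i IH].
  rewrite (_ : [set w | _] = setT)//.
  by apply/seteqP; split.
rewrite (_ : [set w | _] =
    [set w | mkseq (Z^~ w) (size l) = l] `&` [set w | Z (size l) w = i]).
  exact: measurableI.
apply/seteqP; split => w /=; rewrite size_rcons mkseqS.
  by move/rcons_inj => [].
by move=> [-> ->].
Qed.

(** * A lower bound on the expected return of a process *)

Section generated_process.
Variables (R : realType) (S A : finType) (r : S -> A -> R) (gamma : R).
Hypothesis gamma01 : 0 < gamma < 1.
Variables (pi : S -> A -> R) (P : adversary R S A) (s0 : S).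
Hypothesis pi_policy : stationary_policy pi.
Hypothesis P_stochastic : forall h, stochastic_transition (P h).
Context d (Omega : measurableType d) (Pr : probability Omega R).
Variables (st : nat -> Omega -> S) (ac : nat -> Omega -> A).
Hypothesis generated : generated_process pi P s0 Pr st ac.

Let mst t s : measurable [set w | st t w = s].
Proof. by have [m _ _ _ _] := generated. Qed.

Let mac t a : measurable [set w | ac t w = a].
Proof. by have [_ m _ _ _] := generated. Qed.

Lemma history_event_measurable h : measurable (history_event st ac h).
Proof.
rewrite /history_event (_ : [set w | _] =
    [set w | mkseq (fun i => (st i w, ac i w)) (size h.1) = h.1] `&`
    [set w | st (size h.1) w = h.2]); last by apply/seteqP; split.
apply: measurableI => //.
apply: (measurable_mkseq_fiber (Z := fun i w => (st i w, ac i w))) => t sa.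
exact: measurable_pair_fiber.
Qed.

(** The history up to time [t] is kept along with the step from [t] to [t.+1]:
    the law of the next state is prescribed only given the whole history.  The
    tuple makes the type finite, so that expectations are finite sums. *)
Definition transition_at t w : t.-tuple (S * A) * S * (A * S) :=
  ([tuple (st i w, ac i w) | i < t], st t w, (ac t w, st t.+1 w)).

Lemma transition_at_fiber t (h : t.-tuple (S * A)) s a s' :
  [set w | transition_at t w = (h, s, (a, s'))] =
  history_event st ac (rcons h (s, a), s').
Proof.
have tupleE w : [tuple (st i w, ac i w) | i < t] =
    mkseq (fun i => (st i w, ac i w)) t :> seq _.
  by rewrite /mkseq -val_enum_ord -map_comp.
rewrite /history_event/= size_rcons size_tuple.
apply/seteqP; split => w /=; rewrite mkseqS.
  by move=> [<- <- <- <-]; rewrite tupleE.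
move=> [/rcons_inj[wh <- <-] <-]; congr (_, _, _).
exact/val_inj/(etrans (tupleE w)).
Qed.

Lemma transition_at_measurable t i :
  measurable [set w | transition_at t w = i].
Proof.
move: i => [[h s] [a s']]; rewrite transition_at_fiber.
exact: history_event_measurable.
Qed.

Lemma integral_transition_at t (f : S -> A -> S -> R) :
  (\int[Pr]_w (f (st t w) (ac t w) (st t.+1 w))%:E =
   (\sum_(hs : t.-tuple (S * A) * S)
     fine (Pr (history_event st ac (val hs.1, hs.2))) *
     \sum_a pi hs.2 a *
       \sum_s' P (val hs.1, hs.2) hs.2 a s' * f hs.2 a s')%:E)%E.
Proof.
have [_ _ _ action_law state_law] := generated.
have := @integral_finitely_valued _ _ _ Pr _ _ (@transition_at_measurable t)
  (fun i => f i.1.2 i.2.1 i.2.2).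
move=> -> /=; rewrite -sumEFin.
have pairE (I J : finType) (F : I * J -> \bar R) :
    (\sum_p F p = \sum_i \sum_j F (i, j))%E.
  by rewrite pair_bigA; apply: eq_bigr => -[].
rewrite pairE; apply: eq_bigr => -[h s] _ /=.
rewrite pairE mulr_sumr -sumEFin; apply: eq_bigr => a _.
rewrite mulrA mulr_sumr -sumEFin; apply: eq_bigr => s' _.
rewrite transition_at_fiber (state_law (val h, s)) (action_law (val h, s)) /=.
rewrite !EFinM fineK; last exact: fin_num_measure (history_event_measurable _).
by rewrite muleC !muleA.
Qed.

Lemma transition_at_integrable t (f : S -> A -> S -> R) :
  Pr.-integrable setT (fun w => (f (st t w) (ac t w) (st t.+1 w))%:E).
Proof.
exact: (finitely_valued_integrable Pr (@transition_at_measurable t)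
  (fun i => f i.1.2 i.2.1 i.2.2)).
Qed.

Definition partial_return n w : R :=
  series (fun t => gamma ^+ t * r (st t w) (ac t w)) n.

Lemma partial_return_integrable n :
  Pr.-integrable setT (EFin \o partial_return n).
Proof.
rewrite (_ : _ \o _ = fun w => \sum_(0 <= t < n)
    (gamma ^+ t * r (st t w) (ac t w))%:E)%E.
  apply: integrable_sum => // t _.
  exact: (transition_at_integrable t (fun s a _ => gamma ^+ t * r s a)).
by apply/funext => w /=; rewrite sumEFin.
Qed.

Let M : R := \sum_s \sum_a `|r s a|.

Let term_le w t :
  `|gamma ^+ t * r (st t w) (ac t w)| <= geometric M gamma t.
Proof.
have /andP[g0 _] := gamma01.
rewrite normrM normrX (gtr0_norm g0) /geometric/= mulrC.
rewrite ler_wpM2r// ?exprn_ge0 ?(ltW g0)//.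
exact: ler_norm_sum2_fin.
Qed.

Let M_ge0 : 0 <= M. Proof. by rewrite !sumr_ge0// => s _; rewrite sumr_ge0. Qed.

Let partial_return_le n w : `|partial_return n w| <= M / (1 - gamma).
Proof.
have /andP[g0 g1] := gamma01.
have d0 : 0 < 1 - gamma by rewrite subr_gt0.
apply: (le_trans (ler_norm_sum _ _ _)).
apply: (@le_trans _ _ (series (geometric M gamma) n)).
  by apply: ler_sum => t _; exact: term_le.
rewrite geometric_seriesE ?lt_eqF//= ler_wpM2r ?invr_ge0 ?(ltW d0)//.
by rewrite ler_piMr// lerBlDr lerDl exprn_ge0// ltW.
Qed.

Lemma partial_return_cvg w :
  partial_return ^~ w @ \oo --> discounted_return r gamma (st^~ w) (ac^~ w).
Proof.
have /andP[g0 g1] := gamma01.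
suff : cvgn (series (fun t => gamma ^+ t * r (st t w) (ac t w))) by [].
apply: (@normed_cvg _ R^o).
apply: (@series_le_cvg _ _ (geometric M gamma)) => //=.
- by move=> t; rewrite mulr_ge0// exprn_ge0// ltW.
- by apply: is_cvg_geometric_series; rewrite gtr0_norm.
Qed.

(** Dominated convergence, with the constant [M / (1 - gamma)] bounding all
    partial returns. *)
Lemma discounted_return_limit :
  Pr.-integrable setT
    (fun w => (discounted_return r gamma (st^~ w) (ac^~ w))%:E) /\
  (fun n => \int[Pr]_w (partial_return n w)%:E)%E @ \oo -->
    (\int[Pr]_w (discounted_return r gamma (st^~ w) (ac^~ w))%:E)%E.
Proof.
have mpartial n : measurable_fun setT (partial_return n).
  exact/measurable_EFinP/(measurable_int _ (partial_return_integrable n)).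
have [] // := @dominated_convergence _ _ _ Pr setT measurableT
  (fun n => EFin \o partial_return n)
  (fun w => (discounted_return r gamma (st^~ w) (ac^~ w))%:E)
  (cst (M / (1 - gamma))%:E).
- by move=> n; exact/measurable_EFinP.
- apply/measurable_EFinP.
  apply: (measurable_fun_cvg mpartial) => w _; exact: partial_return_cvg.
- apply: aeW => w _; apply: cvg_EFin; last exact: partial_return_cvg.
  exact: nearW.
- exact: finite_measure_integrable_cst.
- by apply: aeW => w n _ /=; rewrite lee_fin partial_return_le.
Qed.

Variable u : S -> R.
Hypothesis u_le : forall h s, u s <= bellman r gamma pi (P h) u s.

(** The defect of the Bellman inequality along one step; [u_le] makes its
    conditional mean given the history nonnegative. *)
Let gain s a s' := r s a + gamma * u s' - u s.

Lemma integral_gain_ge0 t :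
  (0 <= \int[Pr]_w (gain (st t w) (ac t w) (st t.+1 w))%:E)%E.
Proof.
rewrite integral_transition_at lee_fin; apply: sumr_ge0 => -[h s] _.
apply: mulr_ge0 => /=; first exact/fine_ge0/measure_ge0.
under eq_bigr => a _.
  have Psa := @P_stochastic (val h, s) s a.
  rewrite (_ : \sum_s' _ = (r s a +
      gamma * \sum_s' P (val h, s) s a s' * u s') - u s); last first.
    rewrite -[in RHS](simplex_mean_cst (r s a) Psa).
    rewrite -[in RHS](simplex_mean_cst (u s) Psa).
    rewrite mulr_sumr -big_split -sumrB; apply: eq_bigr => s' _ /=.
    by rewrite /gain; ring.
  rewrite mulrBr; over.
by rewrite sumrB simplex_mean_cst// subr_ge0; exact: u_le.
Qed.

(** Paying the continuation value [u] at time [n] on top of the partial return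
    yields a submartingale: passing from [n] to [n.+1] adds
    [gamma ^+ n] times the gain of the step. *)
Lemma continued_return_ge n :
  ((u s0)%:E <= \int[Pr]_w (partial_return n w + gamma ^+ n * u (st n w))%:E)%E.
Proof.
have intu t c : Pr.-integrable setT (fun w => (c * u (st t w))%:E).
  exact: (transition_at_integrable t (fun s _ _ => c * u s)).
have intY t : Pr.-integrable setT
    (fun w => (partial_return t w + gamma ^+ t * u (st t w))%:E).
  exact: (integrableD measurableT (partial_return_integrable t) (intu t _)).
elim: n => [|n IH].
  have -> : (\int[Pr]_w (partial_return 0 w + gamma ^+ 0 * u (st 0 w))%:E =
      \sum_s (u s)%:E * Pr [set w | st 0%N w = s])%E.
    rewrite -(integral_finitely_valued Pr (mst 0)).
    apply: eq_integral => w _.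
    by rewrite /partial_return /series/= big_geq// add0r expr0 mul1r.
  have [_ _ start _ _] := generated.
  rewrite (bigD1 s0)//= start mule1 big1 ?adde0// => s ss0.
  rewrite (_ : Pr _ = 0)%E ?mule0//.
  have : (Pr [set w | st 0%N w = s] <= Pr (~` [set w | st 0%N w = s0]))%E.
    apply: le_measure; rewrite ?inE//; first exact: measurableC.
    by move=> w /= -> /eqP; rewrite (negbTE ss0).
  rewrite probability_setC// start subee// => le0.
  by apply/eqP; rewrite eq_le le0 measure_ge0.
apply: (le_trans IH).
under [leRHS]eq_integral => w _.
  rewrite (_ : _ + _ = (partial_return n w + gamma ^+ n * u (st n w)) +
      gamma ^+ n * gain (st n w) (ac n w) (st n.+1 w)); last first.
    by rewrite /partial_return seriesSr /gain exprS; ring.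
  over.
rewrite (integralD_EFin measurableT (intY n)); last first.
  exact: (transition_at_integrable n (fun s a s' => gamma ^+ n * gain s a s')).
rewrite leeDl//; under eq_integral do rewrite /= EFinM.
rewrite integralZl//; last exact: (transition_at_integrable n gain).
rewrite mule_ge0 ?integral_gain_ge0// lee_fin exprn_ge0//.
by have /andP[/ltW] := gamma01.
Qed.

(** The continuation value is at most [gamma ^+ n * K], which vanishes in the
    limit. *)
Lemma expected_return_ge :
  ((u s0)%:E <= \int[Pr]_w (discounted_return r gamma (st^~ w) (ac^~ w))%:E)%E.
Proof.
have /andP[g0 g1] := gamma01.
pose K := \sum_s `|u s|.
have lower n : ((u s0 - geometric K gamma n)%:E <=
    \int[Pr]_w (partial_return n w)%:E)%E.
  rewrite EFinB leeBlDr//; apply: (le_trans (continued_return_ge n)).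
  have intu : Pr.-integrable setT (fun w => (gamma ^+ n * u (st n w))%:E).
    exact: (transition_at_integrable n (fun s _ _ => gamma ^+ n * u s)).
  rewrite (integralD_EFin measurableT (partial_return_integrable n))//.
  rewrite leeD2l//.
  apply: (@le_trans _ _ (\int[Pr]_w (geometric K gamma n)%:E)%E).
    apply: le_integral => //; first exact: finite_measure_integrable_cst.
    move=> w _; rewrite lee_fin /geometric/= mulrC.
    rewrite ler_wpM2r ?exprn_ge0 ?(ltW g0)//.
    exact: (le_trans (ler_norm _) (ler_norm_sum_fin u _)).
  by rewrite integral_cst// [X in (_ * X)%E](probability_setT Pr) mule1.
have [_ lim_partial] := discounted_return_limit.
have lim_lower : (u s0 - geometric K gamma n)%:E @[n --> \oo] --> (u s0)%:E.
  apply: cvg_EFin; first exact: nearW.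
  rewrite -[X in _ --> X]subr0; apply: cvgB; first exact: cvg_cst.
  by apply: cvg_geometric; rewrite gtr0_norm.
rewrite -(cvg_lim _ lim_lower)// -(cvg_lim _ lim_partial)//.
apply: lee_lim; [exact: cvgP lim_lower|exact: cvgP lim_partial|].
exact: nearW.
Qed.

End generated_process.

(** * Subdividing the unit interval according to a distribution *)

Section subdivision.
Variables (R : realType) (E : finType) (p : E -> R).
Hypothesis p_distr : simplex p.

(** The distribution function of [p] for the enumeration order of [E]: the
    element [e] owns the interval of length [p e] that starts at
    [rank_sum (enum_rank e)]. *)
Definition rank_sum (n : nat) : R := \sum_(e | (enum_rank e < n)%N) p e.

Let p_ge0 e : 0 <= p e. Proof. by case: p_distr. Qed.

Lemma rank_sumS e : rank_sum (enum_rank e).+1 = rank_sum (enum_rank e) + p e.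
Proof.
rewrite /rank_sum (bigD1 e)//= addrC; congr (_ + _); apply: eq_bigl => e'.
rewrite ltnS ltn_neqAle andbC; congr (_ && _).
by rewrite (inj_eq val_inj) (inj_eq enum_rank_inj).
Qed.

Lemma rank_sum_le : {homo rank_sum : m n / (m <= n)%N >-> m <= n}.
Proof.
move=> m n mn; rewrite /rank_sum [leRHS](bigID (fun e => (enum_rank e < m)%N))/=.
rewrite (eq_bigl (fun e => (enum_rank e < n)%N && (enum_rank e < m)%N)).
  by rewrite lerDl sumr_ge0.
by move=> e; case: ltnP => [em|]; rewrite ?andbF// andbT (leq_trans em).
Qed.

Lemma rank_sum0 : rank_sum 0 = 0. Proof. by rewrite /rank_sum big_pred0. Qed.

Lemma rank_sum_card : rank_sum #|E| = 1.
Proof.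
have [_ <-] := p_distr; apply: eq_bigl => e.
by rewrite ltn_ord.
Qed.

Lemma rank_sum_ge0 n : 0 <= rank_sum n.
Proof. exact: sumr_ge0. Qed.

Lemma rank_sum_le1 e : rank_sum (enum_rank e) + p e <= 1.
Proof. by rewrite -rank_sumS -rank_sum_card rank_sum_le. Qed.

Lemma subdivision_exists x : 0 <= x < 1 ->
  exists e, rank_sum (enum_rank e) <= x < rank_sum (enum_rank e) + p e.
Proof.
move=> /andP[x0 x1].
have exn : exists n, x < rank_sum n by exists #|E|; rewrite rank_sum_card.
case: (ex_minnP exn) => -[|n] xn n_min.
  by move: xn; rewrite rank_sum0 ltNge x0.
have nE : (n < #|E|)%N by apply: n_min; rewrite rank_sum_card.
exists (enum_val (Ordinal nE)).
rewrite -rank_sumS enum_valK /= xn andbT leNgt; apply/negP => /n_min.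
by rewrite ltnn.
Qed.

Lemma subdivision_unique x e e' :
  rank_sum (enum_rank e) <= x < rank_sum (enum_rank e) + p e ->
  rank_sum (enum_rank e') <= x < rank_sum (enum_rank e') + p e' -> e = e'.
Proof.
wlog ee' : e e' / (enum_rank e <= enum_rank e')%N.
  move=> wlg xe xe'; case/orP: (leq_total (enum_rank e) (enum_rank e')) => ee'.
    exact: wlg.
  by apply/esym/wlg.
rewrite -rank_sumS => /andP[_ xe] /andP[xe' _].
apply/enum_rank_inj/val_inj/eqP; rewrite eqn_leq ee' leqNgt.
apply/negP => /rank_sum_le /le_trans /(_ xe').
by rewrite leNgt xe.
Qed.

End subdivision.

(** * A uniform point of the unit interval *)

Section uniform_unit_interval.
Variable R : realType.

Definition unit_interval_measure : set (measurableTypeR R) -> \bar R :=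
  mrestr (@lebesgue_measure R) (measurable_itv `[0, 1[).

HB.instance Definition _ := Measure.on unit_interval_measure.

Lemma unit_interval_measureT : unit_interval_measure setT = 1%E.
Proof.
rewrite /unit_interval_measure/mrestr setTI lebesgue_measure_itv/=.
by rewrite lte_fin ltr01 -EFinB subr0.
Qed.

HB.instance Definition _ := @Measure_isProbability.Build _ _ R
  unit_interval_measure unit_interval_measureT.

(** The points outside the unit interval form a null set; sending them to [0]
    spares every later statement an exceptional set. *)
Definition to_unit_interval (x : R) : R := if 0 <= x < 1 then x else 0.

Lemma to_unit_interval01 x : 0 <= to_unit_interval x < 1.
Proof. by rewrite /to_unit_interval; case: ifP; rewrite // lexx ltr01. Qed.

Lemma measurable_to_unit_interval : measurable_fun setT to_unit_interval.
Proof.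
apply: measurable_fun_ifT => //.
by apply: measurable_and; apply: measurable_fun_ler || apply: measurable_fun_ltr.
Qed.

Lemma to_unit_interval_uniform a b : 0 <= a -> a <= b -> b <= 1 ->
  unit_interval_measure (to_unit_interval @^-1` `[a, b[) = (b - a)%:E.
Proof.
move=> a0 ab b1; rewrite /unit_interval_measure/mrestr.
rewrite (_ : _ `&` _ = [set` `[a, b[]).
  rewrite lebesgue_measure_itv/= lte_fin; case: ifPn => [_|].
    by rewrite EFinB.
  rewrite -leNgt => ba.
  by rewrite (_ : a = b) ?subrr//; apply/eqP; rewrite eq_le ab ba.
apply/seteqP; split => x /=; rewrite !in_itv/= /to_unit_interval.
  by move=> [+ x01]; rewrite x01.
move=> /andP[ax xb].
have x01 : 0 <= x < 1 by rewrite (le_trans a0 ax) (lt_le_trans xb b1).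
by rewrite x01 ax xb.
Qed.

End uniform_unit_interval.

(** * Random infinite words with prescribed conditional laws *)

Section word_process.
Variables (R : realType) (E : finType) (k : seq E -> E -> R).
Hypothesis k_distr : forall l, simplex (k l).

(** [word_probability h l] is the probability of reading [l] next, once [h] has
    been read; [word_offset h l] is the left end of the interval of [l] when the
    interval of [h] is rescaled to the unit interval. *)
Fixpoint word_probability (h l : seq E) : R :=
  if l is e :: l' then k h e * word_probability (rcons h e) l' else 1.

Fixpoint word_offset (h l : seq E) : R :=
  if l is e :: l' then
    rank_sum (k h) (enum_rank e) + k h e * word_offset (rcons h e) l'
  else 0.

Lemma word_probability_rcons h l e :
  word_probability h (rcons l e) = word_probability h l * k (h ++ l) e.
Proof.
elim: l h => [|e' l IH] h /=; first by rewrite cats0 mulrC.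
by rewrite IH cat_rcons mulrA.
Qed.

Lemma word_offset_rcons h l e : word_offset h (rcons l e) =
  word_offset h l + word_probability h l * rank_sum (k (h ++ l)) (enum_rank e).
Proof.
elim: l h => [|e' l IH] h /=; first by rewrite cats0 mulr0 addr0 add0r mul1r.
by rewrite IH cat_rcons; ring.
Qed.

Definition word_interval l (x : R) : bool :=
  word_offset [::] l <= x < word_offset [::] l + word_probability [::] l.

Lemma word_probability_ge0 h l : 0 <= word_probability h l.
Proof.
by elim: l h => [|e l IH] h //=; rewrite mulr_ge0//; case: (k_distr h).
Qed.

Lemma word_offset_ge0 h l : 0 <= word_offset h l.
Proof.
elim: l h => [|e l IH] h //=.
by rewrite addr_ge0 ?mulr_ge0 ?rank_sum_ge0//; case: (k_distr h).
Qed.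

Lemma word_offset_probability_le1 h l :
  word_offset h l + word_probability h l <= 1.
Proof.
elim: l h => [|e l IH] h /=; first by rewrite add0r.
rewrite -addrA -mulrDr; apply: le_trans (rank_sum_le1 (k_distr h) e).
by rewrite lerD2l ler_piMr//; case: (k_distr h).
Qed.

Let rescale l x := (x - word_offset [::] l) / word_probability [::] l.

(** Rescaling the interval of [l] to the unit interval turns the intervals of
    the one-letter extensions of [l] into the subdivision by the law of the next
    letter. *)
Lemma word_interval_rcons l e x : word_interval l x ->
  word_interval (rcons l e) x =
  (rank_sum (k l) (enum_rank e) <= rescale l x
    < rank_sum (k l) (enum_rank e) + k l e).
Proof.
rewrite /word_interval => /andP[lx xl].
have p0 : 0 < word_probability [::] l.
  by rewrite -(ltrD2l (word_offset [::] l)) addr0 (le_lt_trans lx).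
rewrite word_offset_rcons word_probability_rcons /rescale /=.
rewrite ler_pdivlMr// ltr_pdivrMr// lerBrDr ltrBlDr mulrDl.
by congr (_ && _); [congr (_ <= _)|congr (_ < _)]; ring.
Qed.

Lemma word_interval_belast l e x :
  word_interval (rcons l e) x -> word_interval l x.
Proof.
rewrite /word_interval word_offset_rcons word_probability_rcons /=.
move=> /andP[lx xl]; apply/andP; split.
  by apply: le_trans lx; rewrite lerDl mulr_ge0 ?word_probability_ge0 ?rank_sum_ge0.
apply: (lt_le_trans xl); rewrite -addrA lerD2l -mulrDr.
by rewrite ler_piMr ?word_probability_ge0 ?rank_sum_le1.
Qed.

(** Words of the same length own disjoint intervals, so the prefixes of the
    infinite word of a point are determined by that point. *)
Lemma word_interval_unique l l' x : size l = size l' ->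
  word_interval l x -> word_interval l' x -> l = l'.
Proof.
elim/last_ind: l l' => [|l e IH] l'; first by case: l'.
case/lastP: l' => [|l' e']; first by rewrite size_rcons.
rewrite !size_rcons => -[ll'] lx l'x.
have lxl := word_interval_belast lx.
have E1 := IH _ ll' lxl (word_interval_belast l'x).
rewrite -{}E1 in l'x *; congr rcons.
move: lx l'x; rewrite !word_interval_rcons//; exact: subdivision_unique.
Qed.

Lemma word_interval_extend l x : word_interval l x ->
  exists e, word_interval (rcons l e) x.
Proof.
move=> lx; have [|e le] := @subdivision_exists _ _ _ (k_distr l) (rescale l x).
  move: lx; rewrite /word_interval => /andP[lx xl].
  have p0 : 0 < word_probability [::] l.
    by rewrite -(ltrD2l (word_offset [::] l)) addr0 (le_lt_trans lx).
  by rewrite /rescale ler_pdivlMr// mul0r subr_ge0 lx ltr_pdivrMr// mul1r ltrBlDl.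
by exists e; rewrite word_interval_rcons.
Qed.

Lemma infinite_word_exists x : 0 <= x < 1 ->
  exists X : nat -> E, forall t, word_interval (mkseq X t) x.
Proof.
move=> x01.
have /choice[next nextP] : forall l, exists e,
    word_interval l x -> word_interval (rcons l e) x.
  move=> l; have [lx|nlx] := boolP (word_interval l x).
    by have [e le] := word_interval_extend lx; exists e.
  have [|e _] := @subdivision_exists _ _ _ (k_distr l) 0.
    by rewrite lexx ltr01.
  by exists e.
pose W t := iter t (fun l => rcons l (next l)) [::].
exists (next \o W).
have -> : mkseq (next \o W) = W.
  by apply/funext; elim=> [//|t IH]; rewrite mkseqS IH.
elim=> [|t IH]; last exact: nextP.
by rewrite /word_interval/= add0r.
Qed.

(** The prefix of length [size l] is [l] exactly when the uniform point falls in
    the interval of [l], whose length is the probability of [l]. *)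
Lemma word_process_exists :
  exists (d : measure_display) (Omega : measurableType d)
    (Pr : probability Omega R) (X : nat -> Omega -> E),
  (forall t e, measurable [set w | X t w = e]) /\
  (forall l, Pr [set w | mkseq (X^~ w) (size l) = l] =
    (word_probability [::] l)%:E).
Proof.
have /choice[X XP] : forall w : R, exists X : nat -> E,
    forall t, word_interval (mkseq X t) (to_unit_interval w).
  by move=> w; exact/infinite_word_exists/to_unit_interval01.
have wordE l : [set w | mkseq (X w) (size l) = l] = @to_unit_interval R @^-1`
    `[word_offset [::] l, word_offset [::] l + word_probability [::] l[.
  apply/seteqP; split => w /=; rewrite in_itv/=.
    by move=> wl; have := XP w (size l); rewrite wl.
  by move=> lw; apply: (word_interval_unique _ (XP w _) lw); rewrite size_mkseq.
exists _, (measurableTypeR R), (@unit_interval_measure R), (fun t w => X w t).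
split; last first.
  move=> l; rewrite wordE.
  apply: (etrans (to_unit_interval_uniform _ _ _)).
  - exact: word_offset_ge0.
  - by rewrite lerDl word_probability_ge0.
  - exact: word_offset_probability_le1.
  - by rewrite addrC addKr.
move=> t e.
rewrite (_ : [set w | _] = \bigcup_(l in [set: t.-tuple E])
    [set w | mkseq (X w) (size (rcons l e)) = rcons l e]).
  apply: fin_bigcup_measurable => // l _; rewrite wordE -[X in measurable X]setTI.
  exact: measurable_to_unit_interval.
apply/seteqP; split => w /=.
  move=> <-.
  have sz : size (mkseq (X w) t) == t by rewrite size_mkseq.
  by exists (Tuple sz) => //=; rewrite size_rcons size_mkseq mkseqS.
by move=> [l _] /=; rewrite size_rcons size_tuple mkseqS => /rcons_inj[].
Qed.

End word_process.

(** * Existence of the process generated by a policy and an adversary *)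

Section generated_process_existence.
Variables (R : realType) (S A : finType).
Variables (pi : S -> A -> R) (P : adversary R S A) (s0 : S).
Hypothesis pi_policy : stationary_policy pi.
Hypothesis P_stochastic : forall h, stochastic_transition (P h).

(** The law of the state that follows the state-action pairs [l].  The last pair
    of [l] is the current state and action, so that the history seen by the
    adversary consists of the other pairs and that state. *)
Definition next_state (l : seq (S * A)) : S -> R :=
  if rev l is (s, a) :: l' then P (rev l', s) s a else fun s => (s == s0)%:R.

Lemma next_state_rcons l s a : next_state (rcons l (s, a)) = P (l, s) s a.
Proof. by rewrite /next_state rev_rcons revK. Qed.

Lemma next_state_distr l : simplex (next_state l).
Proof.
rewrite /next_state; case: (rev l) => [|[s a] l']; last exact: P_stochastic.
split=> [s|]; first exact: ler0n.
by rewrite (bigD1 s0)//= eqxx big1 ?addr0// => s /negbTE ->.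
Qed.

Definition next_pair (l : seq (S * A)) (sa : S * A) : R :=
  next_state l sa.1 * pi sa.1 sa.2.

Lemma next_pair_distr l : simplex (next_pair l).
Proof.
split=> [[s a]|].
  by rewrite mulr_ge0//; [case: (next_state_distr l)|case: (pi_policy s)].
rewrite -(pair_bigA _ (fun s a => next_state l s * pi s a))/=.
under eq_bigr => s _ do rewrite -mulr_sumr (proj2 (pi_policy s)) mulr1.
by case: (next_state_distr l).
Qed.

(** The process reads a random word over [S * A].  Its laws are those of words
    of pairs; the law of a history, which ends with a state, is obtained by
    summing over the action that comes next. *)
Lemma generated_process_exists :
  exists (d : measure_display) (Omega : measurableType d)
    (Pr : probability Omega R)
    (st : nat -> Omega -> S) (ac : nat -> Omega -> A),
  generated_process pi P s0 Pr st ac.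
Proof.
have [d [T [Pr [X [mX lawX]]]]] := word_process_exists next_pair_distr.
pose st t w := (X t w).1; pose ac t w := (X t w).2.
have stacE w : (fun t => (st t w, ac t w)) = X^~ w.
  by apply/funext => t; rewrite /st/ac; case: (X t w).
have mst t s : measurable [set w | st t w = s].
  rewrite (_ : [set w | _] =
      \bigcup_(a in [set: A]) [set w | X t w = (s, a)]).
    exact: fin_bigcup_measurable.
  apply/seteqP; split => w /=; last by rewrite /st => -[a _ /= ->].
  by rewrite /st; case E : (X t w) => [s' a] /= ss'; exists a; rewrite //= E ss'.
have mac t a : measurable [set w | ac t w = a].
  rewrite (_ : [set w | _] =
      \bigcup_(s in [set: S]) [set w | X t w = (s, a)]).
    exact: fin_bigcup_measurable.
  apply/seteqP; split => w /=; last by rewrite /ac => -[s _ /= ->].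
  by rewrite /ac; case E : (X t w) => [s a'] /= aa'; exists s; rewrite //= E aa'.
have eventaE h a :
    history_event st ac h `&` [set w | ac (size h.1) w = a] =
    [set w | mkseq (X^~ w) (size (rcons h.1 (h.2, a))) = rcons h.1 (h.2, a)].
  rewrite size_rcons; apply/seteqP; split => w /=; rewrite mkseqS.
    move=> [[+ sth] ach]; rewrite stacE => ->; congr rcons.
    by rewrite -sth -ach /st /ac; case: (X _ w).
  by move=> /rcons_inj[wh Xw]; rewrite /history_event/= stacE wh /st /ac Xw.
have eventE h : history_event st ac h =
    \bigcup_(a in [set: A])
      (history_event st ac h `&` [set w | ac (size h.1) w = a]).
  by rewrite -setI_bigcupr; apply/esym/setIidPl => w _; exists (ac (size h.1) w).
have eventa_law h a :
    Pr (history_event st ac h `&` [set w | ac (size h.1) w = a]) =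
    (word_probability next_pair [::] h.1 * next_state h.1 h.2 * pi h.2 a)%:E.
  by rewrite eventaE lawX word_probability_rcons mulrA.
have meventa h a :
    measurable (history_event st ac h `&` [set w | ac (size h.1) w = a]).
  by rewrite eventaE; exact: measurable_mkseq_fiber.
have event_law h : Pr (history_event st ac h) =
    (word_probability next_pair [::] h.1 * next_state h.1 h.2)%:E.
  have disjoint_actions : trivIset [set: A] (fun a =>
      history_event st ac h `&` [set w | ac (size h.1) w = a]).
    by move=> a b _ _ [w [[_ <-] [_ <-]]].
  have finA : finite_set [set: A] by exact: finite_finset.
  rewrite eventE (measure_fin_bigcup Pr finA disjoint_actions)//.
  rewrite (fsbigE (index_enum A)) ?index_enum_uniq//=; last first.
    by move=> a _; rewrite mem_index_enum.
  rewrite (eq_bigl xpredT); last by move=> a; rewrite in_setT.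
  under eq_bigr do rewrite eventa_law.
  by rewrite sumEFin -mulr_sumr (proj2 (pi_policy h.2)) mulr1.
exists d, T, Pr, st, ac; split => //.
- rewrite (_ : [set w | _] = history_event st ac ([::], s0)).
    by rewrite event_law /= /next_state/= eqxx mulr1.
  by apply/seteqP; split=> w //= [].
- by move=> h a; rewrite eventa_law event_law EFinM.
- move=> [l s] a s'; rewrite event_law eventa_law /= next_state_rcons.
  by rewrite word_probability_rcons /next_pair/= mulrA EFinM.
Qed.

End generated_process_existence.

(** * Values of history-dependent adversaries *)

Section value_lower_bound.
Variables (R : realType) (S A : finType) (r : S -> A -> R) (gamma : R).
Hypothesis gamma01 : 0 < gamma < 1.
Variables (pi : S -> A -> R) (P : adversary R S A).
Hypothesis pi_policy : stationary_policy pi.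
Hypothesis P_stochastic : forall h, stochastic_transition (P h).

(** The value is the expected return of some generated process, once one exists
    and its return is integrable; the bound holds for whichever process is
    chosen. *)
Lemma value_ge (u : S -> R) :
    (forall h s, u s <= bellman r gamma pi (P h) u s) ->
  forall s, u s <= value r gamma pi P s.
Proof.
move=> u_le s; rewrite /value; set V := (X in get X).
have : V (get V).
  apply: getPex.
  have [d [T [Pr [st [ac generated]]]]] :=
    generated_process_exists s pi_policy P_stochastic.
  have [int_return _] := discounted_return_limit r gamma01 generated.
  exists (fine 'E_Pr[fun w => discounted_return r gamma (st^~ w) (ac^~ w)]).
  exists d, T, Pr, st, ac; split=> //.
  by rewrite fineK// expectation_fin_num//; exact/Lfun1_integrable.
move=> [d [T [Pr [st [ac [generated]]]]]].
rewrite -lee_fin => <-; rewrite unlock.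
exact: (expected_return_ge gamma01 pi_policy P_stochastic generated u_le).
Qed.

End value_lower_bound.

Theorem theorem8 (R : realType) (S A : finType)
    (S_nonempty : (0 < #|S|)%N) (A_nonempty : (0 < #|A|)%N)
    (U : set (transition R S A))
    (U_stochastic : U `<=` @stochastic_transition R S A)
    (U_nonempty : U !=set0)
    (U_compact : compact U)
    (U_convex : convex_uncertainty U)
    (U_tractable : weakly_s_tractable U)
    (r : S -> A -> R) (gamma : R) (gamma01 : 0 < gamma < 1)
    (mu : S -> R) (mu_distr : simplex mu)
    (pi : S -> A -> R) (pi_policy : stationary_policy pi) :
  is_minimum [set mean_value r gamma mu pi (cst P) | P in U]
    (inf [set mean_value r gamma mu pi P | P in history_adversaries U]).
Proof.
have /andP[/ltW gamma_ge0 gamma_lt1] := gamma01.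
pose u := robust_value U r gamma pi.
have u_bellman : robust_bellman_solution U r gamma pi u.
  exact: robust_value_bellman.
have u_min := U_tractable pi r gamma mu pi_policy
  (introT andP (conj gamma_ge0 gamma_lt1)) mu_distr.
have lower : lbound
    [set mean_value r gamma mu pi P | P in history_adversaries U]
    (\sum_s mu s * u s).
  move=> _ [P UP <-]; apply: simplex_mean_le => //; apply: value_ge => //.
    by move=> h; exact/U_stochastic/UP.
  by move=> h s; have [_] := u_bellman s; apply; exists (P h).
suff -> : inf [set mean_value r gamma mu pi P | P in history_adversaries U] =
    \sum_s mu s * u s by exact: u_min.
have [[P UP Pu] _] := u_min.
have attained : [set mean_value r gamma mu pi P | P in history_adversaries U]
    (\sum_s mu s * u s).
  by exists (cst P) => // h; exact: UP.
apply/eqP; rewrite eq_le; apply/andP; split.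
  by apply: ge_inf => //; exists (\sum_s mu s * u s).
by apply: lb_le_inf => //; exists (\sum_s mu s * u s).
Qed.
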